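(* Let $a>b>0$, let $$\lambda_0=\frac{-ab(a+b)+2ab\sqrt{a^2-ab+b^2}}{(a-b)^2}\in(0,b),$$ and let $\hat p_3$ be a real polynomial of degree $3$ for which there is a real polynomial $\hat q_1$ of degree $1$ with $$\hat p_3^2(s)-s\left(s-\frac1a\right)\left(s-\frac1b\right)\left(s-\frac1{\lambda_0}\right)\hat q_1^2(s)=1.$$ Then $\hat p_3$ can be expressed, up to a constant factor, through the Zolotarev polynomial $z_3$: for a suitable value of the parameter $\sigma>\tan^2(\pi/6)$ there is a constant $c\neq0$ such that $$\hat p_3(s)=c\,z_3(2as-1).$$
   Context: For a real parameter $\sigma>\tan^2\frac{\pi}{2n}$, the Zolotarev polynomial $z_n=z_n(\,\cdot\,;\sigma)$ is the polynomial of the form $x^n-n\sigma x^{n-1}+p_2x^{n-2}+\dots+p_n$ (with $n,\sigma$ fixed and $p_2,\dots,p_n$ real and free) having the minimal uniform norm on $[-1,1]$. The value $\lambda_0$ above is the parameter of the confocal ellipse $\frac{\mathsf{x}^2}{a-\lambda_0}+\frac{\mathsf{y}^2}{b-\lambda_0}=1$ which is the caustic of the $3$-periodic billiard trajectories within $\frac{\mathsf{x}^2}{a}+\frac{\mathsf{y}^2}{b}=1$. *)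

(* Defs.v *)
From HB Require Import structures.
From mathcomp Require Import all_boot all_order all_algebra.
From mathcomp Require Import all_classical all_reals all_analysis.
Set Implicit Arguments.
Unset Strict Implicit.
Unset Printing Implicit Defensive.
Import Order.TTheory GRing.Theory Num.Theory.
Local Open Scope classical_set_scope.
Local Open Scope ring_scope.

Definition uniform_norm (R : realType) (p : {poly R}) : R :=
  sup [set `|p.[x]| | x in `[-1, 1]].

(* The polynomials x^n - n sigma x^(n-1) + p_2 x^(n-2) + ... + p_n; the free
   coefficients p_2, ..., p_n are those of [r], of degree at most n - 2. *)
Definition zolotarev_form (R : realType) (n : nat) (sigma : R) : set {poly R} :=
  [set p | exists2 r : {poly R}, (size r <= n.-1)%N &
           p = 'X^n - (n%:R * sigma) *: 'X^(n.-1) + r].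

Definition is_zolotarev (R : realType) (n : nat) (sigma : R) (p : {poly R}) :
    Prop :=
  zolotarev_form n sigma p /\
  forall q : {poly R}, zolotarev_form n sigma q ->
    uniform_norm p <= uniform_norm q.

(* "The" minimizer is selected by choice; the default 0 is not of the required
   form when 0 < n, so it is never a minimizer. *)
Definition zolotarev (R : realType) (n : nat) (sigma : R) : {poly R} :=
  xget 0 [set p | is_zolotarev n sigma p].

Definition lambda0 (R : realType) (a b : R) : R :=
  (- (a * b * (a + b)) + 2 * a * b * Num.sqrt (a ^+ 2 - a * b + b ^+ 2))
  / (a - b) ^+ 2.

(* Main.v *)
(** At the four roots 0 < A = 1/a < B = 1/b < L = 1/lambda0 of the quartic,
    p = p3 takes the values 1 and -1. A 2-2 split of the signs is impossible: the
    remaining root of p - v would also be a root of p + v. In a 3-1 split, with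
    v taken at e1, e2, e3 and -v at e4, the polynomial p + v has the simple root
    e4 and a double root d, so comparing coefficients gives two relations between
    d and the e_i. The quadratic equation satisfied by 1/lambda0 leaves only
    e4 = L, with 0 < d < A. Thus p takes the values v, -v, v at 0, d, A, while
    |p| <= 1 on [0, A] by the sign of the quartic. After the change of variable
    x = 2as - 1 these are three alternation points of a cubic on [-1, 1], which
    force it to be the unique minimizer among the cubics with the same two
    leading coefficients; here 3 sigma = 2a/b - 1 > 1 is the third root of
    p - v in the variable x. *)
Require Import Defs.
From HB Require Import structures.
From mathcomp Require Import all_boot all_order all_algebra.
From mathcomp Require Import all_classical all_reals all_analysis.
From mathcomp Require Import ring lra.
Set Implicit Arguments.
Unset Strict Implicit.
Unset Printing Implicit Defensive.
Import Order.TTheory GRing.Theory Num.Theory.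
Local Open Scope ring_scope.

(** * Auxiliary facts on the tangent and on polynomial identities *)

Lemma tan_pi6_sqr (R : realType) : tan (pi / 6) ^+ 2 = 1 / 3 :> R.
Proof.
have hc : 0 < cos (pi / 6) :> R.
  by apply: cos_gt0_pihalf; have := pi_gt0 R => hp; apply/andP; split; lra.
(* Expanding the cosine of the tripled angle and dividing by cos (pi/6) gives a linear relation
   between the squares of cosine and sine. *)
have h3 : cos (pi / 6 *+ 2 + pi / 6) = 0 :> R.
  by rewrite -[RHS](@cos_pihalf R); congr cos; field.
rewrite cosD cos_mulr2n sin_mulr2n in h3.
have hcs := cos2Dsin2 (pi / 6 : R).
rewrite /tan; set c := cos _ in hc h3 hcs *; set s := sin _ in h3 hcs *.
have h4 : 2 * c ^+ 2 - 1 - 2 * s ^+ 2 = 0.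
  by apply: (mulfI (lt0r_neq0 hc)); rewrite mulr0 -h3; ring.
rewrite expr_div_n; have -> : s ^+ 2 = 1 / 4 by lra.
have -> : c ^+ 2 = 3 / 4 by lra.
by field.
Qed.

Lemma poly_eval_eq0 (R : numDomainType) (p : {poly R}) :
  (forall s, p.[s] = 0) -> p = 0.
Proof.
move=> hp.
apply: (@roots_geq_poly_eq0 _ p [seq (k%:R : R) | k <- iota 0 (size p)]).
- by apply/allP => x _; apply/rootP.
- by rewrite map_inj_uniq ?iota_uniq//; exact: mulrIn (oner_neq0 R).
- by rewrite size_map size_iota.
Qed.

(** The factor [u] is cancelled in the integral domain of polynomials, so the equality also holds at
    the roots of [u], where pointwise division fails. *)
Lemma poly_eval_cancel (R : numDomainType) (u v w : {poly R}) : u != 0 ->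
  (forall s, u.[s] * v.[s] = u.[s] * w.[s]) -> forall s, v.[s] = w.[s].
Proof.
move=> u0 h s; congr (_.[s]); apply: (mulfI u0); apply/eqP.
rewrite -subr_eq0; apply/eqP/poly_eval_eq0 => x.
by rewrite hornerD hornerN !hornerM h subrr.
Qed.

Lemma poly_eval_size2 (R : comNzRingType) (q : {poly R}) (s : R) :
  (size q <= 2)%N -> q.[s] = q`_1 * s + q`_0.
Proof.
move=> h; rewrite (horner_coef_wide s h) big_ord_recr big_ord1 /=.
by rewrite expr1 expr0 mulr1 addrC.
Qed.

Lemma size2_coef1_neq0 (R : nzRingType) (q : {poly R}) :
  size q = 2 -> q`_1 != 0.
Proof.
move=> sq; have := lead_coef_eq0 q.
by rewrite lead_coefE sq -size_poly_eq0 sq => ->.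
Qed.

Lemma size_subC (R : nzRingType) (p : {poly R}) (v : R) :
  (1 < size p)%N -> size (p - v%:P) = size p.
Proof.
move=> sp; rewrite size_polyDl// size_polyN.
exact: leq_ltn_trans (size_polyC_leq1 _) sp.
Qed.

(** * Sign patterns of a cubic solution of the Pell equation *)

Section Pell.
Variables (R : realFieldType) (p q : {poly R}).
Hypotheses (sp : size p = 4) (sq : size q = 2).

Let horner_simp :=
  (@hornerXsubC R, @hornerZ R, @hornerM R, @horner_exp R, @hornerD R,
   @hornerC R).

(** Here [p - v] is [k] times the cubic with roots e1, e2, e3. Cancelling that cubic in p^2 - 1 = (p
    - v)(p + v) shows that [p + v] has the roots e4, d, d, where d is the root of [q]. Since [p - v]
    and [p + v] differ by a constant, the first two elementary symmetric functions of their roots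
    agree. *)
Lemma pell_three (v e1 e2 e3 e4 : R) :
    v ^+ 2 = 1 -> uniq [:: e1; e2; e3] ->
    (forall s, p.[s] ^+ 2 - (s - e1) * (s - e2) * (s - e3) * (s - e4)
                 * q.[s] ^+ 2 = 1) ->
    p.[e1] = v -> p.[e2] = v -> p.[e3] = v ->
  exists k d : R, [/\ k != 0, 2 * d + e4 = e1 + e2 + e3,
    d ^+ 2 + 2 * d * e4 = e1 * e2 + e1 * e3 + e2 * e3, p.[d] = - v &
    forall s, p.[s] = v + k * ((s - e1) * (s - e2) * (s - e3))].
Proof.
move=> v2 eU pell h1 h2 h3.
pose u := \prod_(z <- [:: e1; e2; e3]) ('X - z%:P).
have uE s : u.[s] = (s - e1) * (s - e2) * (s - e3).
  by rewrite /u !big_cons big_nil mulr1 !hornerM !hornerXsubC mulrA.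
have u0 : u != 0 by rewrite monic_neq0// monic_prod_XsubC.
have spv : size (p - v%:P) = 4 by rewrite size_subC sp.
pose k := lead_coef (p - v%:P).
have k0 : k != 0 by rewrite lead_coef_eq0 -size_poly_eq0 spv.
have pE s : p.[s] = v + k * ((s - e1) * (s - e2) * (s - e3)).
  have : p - v%:P = k *: u.
    apply: all_roots_prod_XsubC; rewrite ?uniq_rootsE //.
    by rewrite /= !rootE !hornerE h1 h2 h3 subrr eqxx.
  move/(congr1 (horner^~ s)); rewrite hornerZ uE hornerD hornerN hornerC.
  by move=> <-; ring.
have key s : k * (p.[s] + v) = (s - e4) * q.[s] ^+ 2.
  have := @poly_eval_cancel _ u (k *: (p + v%:P)) (('X - e4%:P) * q ^+ 2) u0.
  move=> /(_ _ s); rewrite !horner_simp; apply => {}s.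
  rewrite uE !horner_simp.
  transitivity (p.[s] ^+ 2 - v ^+ 2); first by rewrite pE; ring.
  by rewrite v2 -(pell s); ring.
have q1 := size2_coef1_neq0 sq.
have qE s : q.[s] = q`_1 * s + q`_0 by apply: poly_eval_size2; rewrite sq.
set m := q`_1 in q1 qE; set n := q`_0 in qE.
pose d := - n / m.
have nE : n = - (m * d) by rewrite /d; field.
(* Four values determine a cubic identity; linear combinations of them give its coefficients. *)
have F0 := key 0; have F1 := key 1; have F2 := key (-1); have F3 := key 2.
rewrite !(pE, qE) nE in F0 F1 F2 F3.
have mk : m ^+ 2 = k ^+ 2 by lra.
have k20 : k ^+ 2 != 0 by rewrite expf_neq0.
exists k, d; split => //.
- by apply: (mulfI k20); rewrite -[in LHS]mk; lra.
- by apply: (mulfI k20); rewrite -[in LHS]mk; lra.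
- have /eqP := key d; rewrite qE nE.
  have -> : m * d - m * d = 0 by ring.
  by rewrite expr0n mulr0 mulf_eq0 (negPf k0) /= addr_eq0 => /eqP.
Qed.

Lemma pell_two (v e1 e2 e3 e4 : R) :
    v ^+ 2 = 1 -> e1 != e2 ->
    (forall s, p.[s] ^+ 2 - (s - e1) * (s - e2) * (s - e3) * (s - e4)
                 * q.[s] ^+ 2 = 1) ->
    p.[e1] = v -> p.[e2] = v -> p.[e3] = - v -> p.[e4] = - v -> False.
Proof.
move=> v2 e12 pell h1 h2 h3 h4.
have v0 : v != 0 by apply/eqP => vz; move: v2; rewrite vz; lra.
have [r rE] : exists r, p - v%:P = r * (('X - e1%:P) * ('X - e2%:P)).
  have /(@uniq_roots_prod_XsubC _ _ [:: e1; e2]) :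
      all (root (p - v%:P)) [:: e1; e2].
    by rewrite /= !rootE !hornerE h1 h2 subrr eqxx.
  rewrite uniq_rootsE /= inE e12 => /(_ isT) [r ->].
  by exists r; rewrite !big_cons big_nil mulr1.
pose u := ('X - e1%:P) * ('X - e2%:P).
have u0 : u != 0 by rewrite monic_neq0// monicMl monicXsubC.
have uE s : u.[s] = (s - e1) * (s - e2) by rewrite hornerM !hornerXsubC.
have spv : size (p - v%:P) = 4 by rewrite size_subC sp.
have r0 : r != 0.
  by apply/eqP => rz; move: spv; rewrite rE rz mul0r size_poly0.
have sr : size r = 2.
  move: spv; rewrite rE size_mul// size_mul ?polyXsubC_eq0// !size_XsubC /=.
  by rewrite addnC => -[].
have pE s : p.[s] = v + r.[s] * ((s - e1) * (s - e2)).
  move/(congr1 (horner^~ s)): rE; rewrite hornerM uE hornerD hornerN hornerC.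
  by move=> <-; ring.
have key s : r.[s] * (p.[s] + v) = (s - e3) * (s - e4) * q.[s] ^+ 2.
  have := @poly_eval_cancel _ u (r * (p + v%:P))
           (('X - e3%:P) * ('X - e4%:P) * q ^+ 2) u0.
  move=> /(_ _ s); rewrite !horner_simp; apply => {}s.
  rewrite uE !horner_simp.
  transitivity (p.[s] ^+ 2 - v ^+ 2); first by rewrite pE; ring.
  by rewrite v2 -(pell s); ring.
have r1 := size2_coef1_neq0 sr.
have q1 := size2_coef1_neq0 sq.
have lin s : r.[s] = r`_1 * s + r`_0 by apply: poly_eval_size2; rewrite sr.
(* The third root of [p - v]. By [key] it must be a root of [q], as [p] takes the value -v, not v,
   at e3 and e4. *)
pose f := - r`_0 / r`_1.
have rf : r.[f] = 0 by rewrite lin /f; field.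
have pf : p.[f] = v by rewrite pE rf mul0r addr0.
have vN : v != - v by rewrite -subr_eq0; apply/eqP; lra.
have f3 : f - e3 != 0.
  by rewrite subr_eq0; apply/eqP => fe; move: vN; rewrite -{1}pf fe h3 eqxx.
have f4 : f - e4 != 0.
  by rewrite subr_eq0; apply/eqP => fe; move: vN; rewrite -{1}pf fe h4 eqxx.
have qf : q.[f] = 0.
  have /eqP := key f; rewrite rf mul0r eq_sym !mulf_eq0 (negPf f3) (negPf f4).
  by rewrite /= orbb => /eqP.
have qlin s : q.[s] = q`_1 * (s - f).
  have qE t : q.[t] = q`_1 * t + q`_0 by apply: poly_eval_size2; rewrite sq.
  by move: qf; rewrite !qE => h; lra.
have rlin s : r.[s] = r`_1 * (s - f) by rewrite lin /f; field.
(* As [q] enters squared, one factor s - f survives the cancellation. At f this leaves 2v = 0. *)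
have /(_ f) : forall s, (r`_1 *: (p + v%:P)).[s] =
    (q`_1 ^+ 2 *: (('X - e3%:P) * ('X - e4%:P) * ('X - f%:P))).[s].
  apply: (@poly_eval_cancel _ ('X - f%:P)); first by rewrite polyXsubC_eq0.
  move=> s; have := key s; rewrite rlin qlin !horner_simp => h.
  by transitivity (r`_1 * (s - f) * (p.[s] + v)); [ring | rewrite h; ring].
rewrite !horner_simp pf subrr !mulr0 => /eqP.
by rewrite mulf_eq0 (negPf r1) /= => /eqP h; move/eqP: v0; apply; lra.
Qed.

End Pell.

(** * Uniform norm and alternation *)

Lemma poly_itv_bounded (R : realType) (p : {poly R}) :
  exists M, forall x, x \in `[-1, 1] -> `|p.[x]| <= M.
Proof.
elim/poly_ind: p => [|p c [M hM]].
  by exists 0 => x _; rewrite horner0 normr0.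
exists (M + `|c|) => x hx; rewrite hornerMXaddC.
apply: (le_trans (ler_normD _ _)); rewrite lerD2r normrM.
rewrite -[leRHS]mulr1 ler_pM ?hM//.
by rewrite ler_norml; move: hx; rewrite in_itv.
Qed.

(** Boundedness of the set of values makes [sup] an upper bound; for an unbounded set it is 0 by
    convention. *)
Lemma le_uniform_norm (R : realType) (p : {poly R}) (x : R) :
  x \in `[-1, 1] -> `|p.[x]| <= uniform_norm p.
Proof.
move=> hx; apply: ub_le_sup; last by exists x.
by have [M hM] := poly_itv_bounded p; exists M => _ [y hy <-]; exact: hM.
Qed.

Lemma uniform_norm_le (R : realType) (p : {poly R}) (M : R) :
  (forall x, x \in `[-1, 1] -> `|p.[x]| <= M) -> uniform_norm p <= M.
Proof.
move=> hM; apply: ge_sup.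
  by exists `|p.[0]|, 0 => //=; rewrite in_itv /=; lra.
by move=> _ [y hy <-]; exact: hM.
Qed.

(* A competitor of norm at most h differs from [p] by a linear polynomial that
   is >= 0 at both ends and <= 0 at d, hence vanishes. *)
Lemma zolotarev_alternation (R : realType) (sigma d h : R) (p : {poly R}) :
    zolotarev_form 3 sigma p -> -1 < d < 1 ->
    p.[-1] = - h -> p.[1] = - h -> p.[d] = h ->
    (forall x, x \in `[-1, 1] -> `|p.[x]| <= h) ->
  zolotarev 3 sigma = p.
Proof.
move=> fp /andP[d1 d2] pN1 p1 pd pb.
have uniq_q q : zolotarev_form 3 sigma q -> uniform_norm q <= h -> q = p.
  move=> fq qh; have qb x : x \in `[-1, 1] -> - h <= q.[x] <= h.
    by move=> hx; rewrite -ler_norml (le_trans (le_uniform_norm _ hx)).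
  have /andP[b1 _] : - h <= q.[-1] <= h by apply: qb; rewrite in_itv /=; lra.
  have /andP[b2 _] : - h <= q.[1] <= h by apply: qb; rewrite in_itv /=; lra.
  have /andP[_ b3] : - h <= q.[d] <= h by apply: qb; rewrite in_itv /=; lra.
  have sz : (size (q - p)%R <= 2)%N.
    case: fp fq => [r1 s1 ->] [r2 s2 ->].
    have -> : forall u : {poly R}, u + r2 - (u + r1) = r2 - r1.
      by move=> u; ring.
    by rewrite (leq_trans (size_polyD _ _))// geq_max size_polyN s1 s2.
  have qpE x : q.[x] = p.[x] + ((q - p)`_1 * x + (q - p)`_0).
    by rewrite -(poly_eval_size2 _ sz) hornerD hornerN; ring.
  rewrite qpE in b1; rewrite qpE in b2; rewrite qpE in b3.
  set m := (q - p)`_1 in qpE b1 b2 b3; set n := (q - p)`_0 in qpE b1 b2 b3.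
  have c1 : 0 <= n - m by lra.
  have c2 : 0 <= n + m by lra.
  have c3 : m * d + n <= 0 by lra.
  (* The two nonnegative products add up to 2(md + n) <= 0, so both vanish. *)
  have t1 : 0 <= (n - m) * (1 - d) by rewrite mulr_ge0//; lra.
  have t2 : 0 <= (n + m) * (1 + d) by rewrite mulr_ge0//; lra.
  have d1N : 1 - d != 0 by apply: lt0r_neq0; lra.
  have d2N : 1 + d != 0 by apply: lt0r_neq0; lra.
  have m1 : n - m = 0 by apply: (mulIf d1N); rewrite mul0r; lra.
  have m2 : n + m = 0 by apply: (mulIf d2N); rewrite mul0r; lra.
  apply/eqP; rewrite -subr_eq0; apply/eqP/poly_eval_eq0 => x.
  have m0 : m = 0 by lra.
  have n0 : n = 0 by lra.
  by rewrite hornerD hornerN qpE m0 n0 mul0r !addr0 subrr.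
apply: xget_unique.
  (* A competitor of norm below h would equal [p], but [p] attains h at [d]. *)
  split=> // q fq; rewrite (le_trans (uniform_norm_le pb))// leNgt.
  apply/negP => lt; have /ltW/(uniq_q _ fq) qp := lt.
  move: lt; rewrite qp ltNge; apply/negP; rewrite negbK -pd.
  by rewrite (le_trans (ler_norm _))// le_uniform_norm// in_itv /=; lra.
move=> q [fq qmin]; apply: uniq_q => //.
by rewrite (le_trans (qmin _ fp))// uniform_norm_le.
Qed.

(** * Location and quadratic equation of [lambda0] *)

Lemma lambda0_bounds (R : realType) (a b : R) : 0 < b -> b < a ->
  0 < lambda0 a b < b.
Proof.
move=> hb hab; rewrite /lambda0; set r := Num.sqrt _.
have r0 : 0 <= r by exact: sqrtr_ge0.
have r2 : r ^+ 2 = a ^+ 2 - a * b + b ^+ 2 by rewrite sqr_sqrtr//; nra.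
have ab2 : 0 < (a - b) ^+ 2 by rewrite exprn_gt0// subr_gt0.
(* The difference of the squares is 3(a - b)^2. This bound gives [lambda0 a b > 0], and [hi] gives
   [lambda0 a b < b]. *)
have lo : a + b < 2 * r by nra.
have hi : 2 * a * r < 2 * a ^+ 2 - a * b + b ^+ 2.
  rewrite -(@ltr_pXn2r _ 2) ?nnegrE//; last 2 first.
  - by rewrite !mulr_ge0//; lra.
  - by nra.
  have -> : (2 * a * r) ^+ 2 = 4 * a ^+ 2 * r ^+ 2 by ring.
  rewrite r2 -subr_gt0.
  have -> : (2 * a ^+ 2 - a * b + b ^+ 2) ^+ 2 -
    4 * a ^+ 2 * (a ^+ 2 - a * b + b ^+ 2) = b ^+ 2 * (a - b) ^+ 2 by ring.
  by rewrite mulr_gt0// exprn_gt0.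
apply/andP; split.
  rewrite divr_gt0//.
  have -> : - (a * b * (a + b)) + 2 * a * b * r =
    a * b * (2 * r - (a + b)) by ring.
  by rewrite !mulr_gt0//; lra.
rewrite ltr_pdivrMr// -subr_gt0.
have -> : b * (a - b) ^+ 2 - (- (a * b * (a + b)) + 2 * a * b * r) =
   b * (2 * a ^+ 2 - a * b + b ^+ 2 - 2 * a * r) by ring.
by rewrite mulr_gt0// subr_gt0.
Qed.

Lemma lambda0_inv_eq (R : realType) (a b : R) : 0 < b -> b < a ->
  (1 / a - 1 / b) ^+ 2 + 2 * (1 / lambda0 a b) * (1 / a + 1 / b)
    = 3 * (1 / lambda0 a b) ^+ 2.
Proof.
move=> hb hab; have /andP[l0 _] := lambda0_bounds hb hab.
have ha : 0 < a by lra.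
have r2 : Num.sqrt (a ^+ 2 - a * b + b ^+ 2) ^+ 2 = a ^+ 2 - a * b + b ^+ 2.
  by rewrite sqr_sqrtr//; nra.
move: l0; set l := lambda0 a b => l0.
have ab0 : a - b != 0 by rewrite subr_eq0; apply/eqP; lra.
have lE : l * (a - b) ^+ 2 + a * b * (a + b) =
   2 * a * b * Num.sqrt (a ^+ 2 - a * b + b ^+ 2).
  by rewrite /l /lambda0 mulfVK ?expf_neq0//; ring.
(* Multiplied by (a - b)^2, the left side is a completed square minus a constant, and [lE] evaluates
   the square. Division by (abl)^2 then yields the equation for 1/l. *)
have lE2 : (a - b) ^+ 2 * l ^+ 2 + 2 * a * b * (a + b) * l = 3 * (a * b) ^+ 2.
  apply: (mulfI (expf_neq0 2 ab0)).
  transitivity ((l * (a - b) ^+ 2 + a * b * (a + b)) ^+ 2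
                - (a * b * (a + b)) ^+ 2); first by ring.
  by rewrite lE exprMn r2; ring.
have a0 : a != 0 by exact: lt0r_neq0.
have b0 : b != 0 by exact: lt0r_neq0.
have lN0 : l != 0 by exact: lt0r_neq0.
transitivity (((a - b) ^+ 2 * l ^+ 2 + 2 * a * b * (a + b) * l)
              / ((a * b) ^+ 2 * l ^+ 2)); first by field; rewrite a0 b0 lN0.
by rewrite lE2; field; rewrite a0 b0 lN0.
Qed.

Lemma pell_confocal (R : realFieldType) (A B L : R) (p q : {poly R}) :
    0 < A -> A < B -> B < L ->
    (A - B) ^+ 2 + 2 * L * (A + B) = 3 * L ^+ 2 ->
    size p = 4 -> size q = 2 ->
    (forall s, p.[s] ^+ 2 - s * (s - A) * (s - B) * (s - L) * q.[s] ^+ 2 = 1) ->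
  exists v k d : R, [/\ v ^+ 2 = 1, k != 0, 0 < d < A, p.[d] = - v &
    forall s, p.[s] = v + k * (s * (s - A) * (s - B))].
Proof.
move=> hA hAB hBL hL sp sq pell.
(* Otherwise 3L^2 - 2L(A + B) >= L^2 >= (A + B)^2 > (A - B)^2. *)
have LAB : L < A + B by nra.
have sgn x : p.[x] ^+ 2 = 1 -> p.[x] = p.[0] \/ p.[x] = - p.[0].
  have := pell 0; rewrite !(mul0r, subr0) => <- /eqP.
  by rewrite eqf_sqr => /orP[] /eqP; [left|right].
have v0 : p.[0] ^+ 2 = 1 by have := pell 0; rewrite !(mul0r, subr0).
have vA := pell A; have vB := pell B; have vL := pell L.
rewrite subrr !(mulr0, mul0r) subr0 in vA.
rewrite subrr !(mulr0, mul0r) subr0 in vB.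
rewrite subrr !(mulr0, mul0r) subr0 in vL.
have vN : (- p.[0]) ^+ 2 = 1 by rewrite sqrrN.
have U (x y z : R) : x < y -> y < z -> uniq [:: x; y; z].
  by move=> xy yz; rewrite /= !inE !lt_eqF//; exact: lt_trans yz.
have ne (x y : R) : x < y -> x != y by move=> xy; rewrite lt_eqF.
have hB : 0 < B by lra.
have hL0 : 0 < L by lra.
have hAL : A < L by lra.
have pellE (e1 e2 e3 e4 : R) :
   (forall s, (s - e1) * (s - e2) * (s - e3) * (s - e4) =
              s * (s - A) * (s - B) * (s - L)) -> forall s,
   p.[s] ^+ 2 - (s - e1) * (s - e2) * (s - e3) * (s - e4) * q.[s] ^+ 2 = 1.
  by move=> h s; rewrite h.
have [eA|eA] := sgn A vA; have [eB|eB] := sgn B vB; have [eL|eL] := sgn L vL.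
(* Equal values at all four points would give the cubic [p - v] four roots. *)
- have [k [d [k0 _ _ _ pE]]] := pell_three sp sq v0 (U _ _ _ hA hAB)
    (pellE 0 A B L (fun s => ltac:(ring))) erefl eA eB.
  have := pE L; rewrite eL subr0 => /eqP.
  rewrite -subr_eq0 opprD addrA subrr sub0r.
  by rewrite oppr_eq0 !mulf_eq0 (negPf k0) !subr_eq0 !gt_eqF.
- have [k [d [k0 h1 h2 pd pE]]] := pell_three sp sq v0 (U _ _ _ hA hAB)
    (pellE 0 A B L (fun s => ltac:(ring))) erefl eA eB.
  (* From 2d = A + B - L, positivity of d is [LAB], and d < A is B < L. *)
  exists p.[0], k, d; split=> //; first by apply/andP; split; lra.
  by move=> s; rewrite {1}pE subr0.
- have [k [d [_ h1 h2 _ _]]] := pell_three sp sq v0 (U _ _ _ hA hAL)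
    (pellE 0 A L B (fun s => ltac:(ring))) erefl eA eL.
  by exfalso; nra.
- by exfalso; apply: (pell_two sp sq v0 (ne _ _ hA)
    (pellE 0 A B L (fun s => ltac:(ring)))).
- have [k [d [_ h1 h2 _ _]]] := pell_three sp sq v0 (U _ _ _ hB hBL)
    (pellE 0 B L A (fun s => ltac:(ring))) erefl eB eL.
  by exfalso; nra.
- by exfalso; apply: (pell_two sp sq v0 (ne _ _ hB)
    (pellE 0 B A L (fun s => ltac:(ring)))).
- by exfalso; apply: (pell_two sp sq v0 (ne _ _ hL0)
    (pellE 0 L A B (fun s => ltac:(ring)))).
(* With e4 = 0, eliminating d and using [hL] gives L = A + B, contrary to [LAB]. *)
- have [k [d [_ h1 h2 _ _]]] := pell_three sp sq vN (U _ _ _ hAB hBL)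
    (pellE A B L 0 (fun s => ltac:(ring))) eA eB eL.
  by exfalso; nra.
Qed.

(** * Change of variable and identification with the Zolotarev polynomial *)

Theorem proposition5p1 (R : realType) (a b : R) (hb : 0 < b) (hab : b < a) :
  (0 < lambda0 a b /\ lambda0 a b < b) /\
  forall p3 : {poly R}, size p3 = 4%N ->
    (exists q1 : {poly R}, size q1 = 2%N /\
       forall s : R,
         p3.[s] ^+ 2
         - s * (s - 1 / a) * (s - 1 / b) * (s - 1 / lambda0 a b) * q1.[s] ^+ 2
         = 1) ->
    exists sigma : R, tan (pi / 6) ^+ 2 < sigma /\
      exists c : R, c != 0 /\
        forall s : R, p3.[s] = c * (zolotarev 3 sigma).[2 * a * s - 1].
Proof.
have /andP[l0 lb] := lambda0_bounds hb hab.
split=> // p sp [q [sq pell]].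
have ha : 0 < a by lra.
have a0 : a != 0 by exact: lt0r_neq0.
have b0 : b != 0 by exact: lt0r_neq0.
have hA : 0 < 1 / a by rewrite divr_gt0.
have hAB : 1 / a < 1 / b by rewrite !div1r ltf_pV2.
have hBL : 1 / b < 1 / lambda0 a b by rewrite !div1r ltf_pV2.
have [v [k [d [v2 k0 /andP[d0 dA] pd pE]]]] :=
  pell_confocal hA hAB hBL (lambda0_inv_eq hb hab) sp sq pell.
(* With x = 2as - 1 the roots 0, 1/a, 1/b become -1, 1, [beta], and each linear factor in s is
   1/(2a) times the one in x. *)
pose c := k / (8 * a ^+ 3); pose beta := 2 * a / b - 1.
have c0 : c != 0.
  by rewrite mulf_neq0// invr_neq0// mulf_neq0 ?expf_neq0// pnatr_eq0.
pose z : {poly R} := ('X ^+ 2 - 1) * ('X - beta%:P) + (v / c)%:P.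
have zE x : z.[x] = (x ^+ 2 - 1) * (x - beta) + v / c.
  rewrite /z hornerD hornerM hornerXsubC hornerC hornerD hornerN hornerXn.
  by rewrite hornerC.
have pz s : p.[s] = c * z.[2 * a * s - 1].
  by rewrite pE zE /c /beta; field; rewrite a0 b0 k0.
have ad : 0 < 2 * a * d by rewrite !mulr_gt0.
have ad2 : 2 * a * d < 2.
  have e : 2 * a * (1 / a) = 2 by field.
  by rewrite -[ltRHS]e ltr_pM2l// mulr_gt0.
have beta1 : 1 < beta.
  suff : 2 < 2 * a / b by rewrite /beta; lra.
  by rewrite ltr_pdivlMr// ltr_pM2l.
have zd : z.[2 * a * d - 1] = - v / c.
  by apply: (mulfI c0); rewrite -pz pd; field.
(* The extremal value h = -v/c is positive: [z] rises from v/c at the endpoints to -v/c at an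
   interior point, since (x^2 - 1)(x - beta) > 0 there. *)
have h0 : 0 < - v / c.
  move: zd; rewrite zE => h.
  have : 0 < ((2 * a * d - 1) ^+ 2 - 1) * (2 * a * d - 1 - beta).
    by rewrite nmulr_rgt0; nra.
  lra.
have zolo : zolotarev 3 (beta / 3) = z.
  apply: (@zolotarev_alternation _ _ (2 * a * d - 1) (- v / c)) => //.
  (* The expansion of [z] is x^3 - beta x^2 - x + (beta + v/c). *)
  - exists (- 'X + (beta + v / c)%:P).
      rewrite (leq_trans (size_polyD _ _))// geq_max size_polyN size_polyX /=.
      by rewrite (leq_trans (size_polyC_leq1 _)).
    have -> : 3%:R * (beta / 3) = beta by field.
    by rewrite /z -mul_polyC (polyCD beta); ring.
  - by apply/andP; split; lra.
  - by rewrite zE; lra.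
  - by rewrite zE; lra.
  - move=> x; rewrite in_itv /= => /andP[x1 x2].
    have xE : x = 2 * a * ((x + 1) / (2 * a)) - 1 by field.
    set s := (x + 1) / (2 * a) in xE.
    have s0 : 0 <= s by rewrite divr_ge0//; lra.
    have sA : s <= 1 / a.
      have -> : 1 / a = 2 / (2 * a) by field.
      by rewrite ler_pM2r ?invr_gt0; lra.
    have D : s * (s - 1 / a) * (s - 1 / b) * (s - 1 / lambda0 a b) <= 0.
      rewrite mulr_ge0_le0//; last lra.
      by rewrite mulr_le0//; [rewrite mulr_ge0_le0//; lra | lra].
    have p1 : p.[s] ^+ 2 <= v ^+ 2.
      by rewrite v2 -(pell s) -subr_ge0 addrAC subrr add0r oppr_ge0
                 mulr_le0_ge0// sqr_ge0.
    (* The sign of [c] is not known, so squares are compared after multiplication by c^2, where c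
       z(x) = p(s). *)
    rewrite -(@ler_pXn2r _ 2) ?nnegrE ?(ltW h0)// real_normK ?num_real//.
    rewrite -(@ler_pM2l _ (c ^+ 2)); last by rewrite lt0r sqrf_eq0 c0 sqr_ge0.
    rewrite -!exprMn {1}xE -pz (le_trans p1)//.
    by rewrite (_ : c * (- v / c) = - v) ?sqrrN//; field.
exists (beta / 3); split; first by rewrite tan_pi6_sqr; lra.
by exists c; split=> // s; rewrite zolo.
Qed.
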